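(* Let $\ell\in\{-1,0,1\}$ and let $X\sim p$. Fix an integer $r\in\mathbb{N}_0$ and let $\mathbf{v}(x)=(v_1(x),\dots,v_r(x))'\in\mathbb{R}^r$ be a (column) vector of real-valued functions. Let $g:\mathbb{R}\to\mathbb{R}$ be any function such that $v_k g\in L^1(p)$ for all $k=1,\dots,r$. Then, for all $u,v\in\mathcal{S}(p)$ such that the expectations below exist and are finite, \begin{align*} &\mathbb{E}\left[\mathbf{v}(X)g(X)\Phi_p^{\ell}(u,X,v)\right]\,\mathbb{E}\left[\mathbf{v}'(X)g(X)\Phi_p^{\ell}(u,X,v)\right]\\ &\qquad=\mathbb{E}\left[\mathbf{v}(X)\mathbf{v}'(X)\Phi_p^{\ell}(u,X,v)\right]\,\mathbb{E}\left[g^2(X)\Phi_p^{\ell}(u,X,v)\right]-R^{\ell}(u,v;\mathbf{v},g), \end{align*} where $R^\ell(u,v;\mathbf{v},g)$ is the $r\times r$ matrix $$R^{\ell}(u,v;\mathbf{v},g)=\mathbb{E}\left[(\mathbf{v}_3g_4-\mathbf{v}_4g_3)(\mathbf{v}_3g_4-\mathbf{v}_4g_3)'\,\Phi_p^{\ell}(u,X_3,X_4,v)\right],$$ with $X_3,X_4$ two independent copies of $X$, $\mathbf{v}_j=\mathbf{v}(X_j)$ and $g_j=g(X_j)$ for $j=3,4$.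
   Context: A prime on a vector denotes transposition. $X$ is a real random variable with density $p$ with respect to a measure $\mu$, with support $\mathcal{S}(p)=\{x:p(x)>0\}$. Either $\mu$ is the counting measure on $\mathbb{Z}$ (discrete case, $\ell\in\{-1,1\}$) and $\mathcal{S}(p)=[a,b]\cap\mathbb{Z}$ for some $a,b\in\mathbb{Z}\cup\{-\infty,\infty\}$; or $\mu$ is the Lebesgue measure on $\mathbb{R}$ (continuous case, $\ell=0$) and the closure of $\mathcal{S}(p)$ is $[a,b]$ for some $a,b\in\mathbb{R}\cup\{-\infty,\infty\}$. $L^1(p)$ is the set of real-valued $f$ with $\mathbb{E}|f(X)|<\infty$. Set $a_\ell=\mathbb{I}[\ell=1]$ and define $\chi^{\ell}(x,y)=\mathbb{I}[x\le y-a_\ell]$ (so $\chi^{\ell^2}$ is $\chi^0$ if $\ell=0$ and $\chi^{1}$ if $\ell=\pm1$). For $u,x,x_1,x_2,v\in\mathcal{S}(p)$, $$\Phi_p^{\ell}(u,x,v)=\frac{\chi^{\ell}(u,x)\chi^{-\ell}(x,v)}{p(x)},\qquad \Phi_p^{\ell}(u,x_1,x_2,v)=\frac{\chi^{\ell}(u,x_1)\,\chi^{\ell^2}(x_1,x_2)\,\chi^{-\ell}(x_2,v)}{p(x_1)p(x_2)}.$$ *)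

(* Defs.v *)
From HB Require Import structures.
From mathcomp Require Import all_boot all_order all_algebra.
From mathcomp Require Import all_classical all_reals all_analysis.
Set Implicit Arguments.
Unset Strict Implicit.
Unset Printing Implicit Defensive.
Import Order.TTheory GRing.Theory Num.Theory.
Import numFieldNormedType.Exports.

Local Open Scope classical_set_scope.
Local Open Scope ring_scope.

Section Reference.
Variable R : realType.

Lemma measurable_range_intr :
  measurable (range (intr : int -> R) : set (measurableTypeR R)).
Proof.
apply: countable_measurable; first by move=> x; exact: measurable_set1.
apply: card_le_trans; first exact: card_image_le.
exact: countableP.
Qed.

(* The counting measure on Z, carried by the Borel sets of R. *)
Definition counting_int : {measure set (measurableTypeR R) -> \bar R} :=
  mrestr (@counting (measurableTypeR R) R) measurable_range_intr.

Definition supp (p : R -> R) : set R := [set x | 0 < p x].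

Definition chi (l : int) (x y : R) : R := (x <= y - (l == 1)%:R)%R%:R.

(* Outside [supp p] the factors [(p _)^-1] are not meaningful in the source;
   there [p] vanishes and so do [Phi] and [Phi2], since [0^-1 = 0]. *)
Definition Phi (l : int) (p : R -> R) (u x v : R) : R :=
  chi l u x * chi (- l) x v / p x.

Definition Phi2 (l : int) (p : R -> R) (u x1 x2 v : R) : R :=
  chi l u x1 * chi (l ^+ 2) x1 x2 * chi (- l) x2 v / (p x1 * p x2).

End Reference.
Arguments counting_int {R}.

Section Probability.
Context d (T : measurableType d) (R : realType) (P : probability T R).

Definition has_density (mu : {measure set (measurableTypeR R) -> \bar R})
    (X : {RV P >-> measurableTypeR R}) (p : R -> R) : Prop :=
  [/\ measurable_fun [set: measurableTypeR R] (p : measurableTypeR R -> R),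
      (forall x, 0 <= p x) &
      forall A : set (measurableTypeR R), measurable A ->
        distribution P X A = (\int[mu]_(x in A) (p x)%:E)%E].

(* The endpoints [a], [b] may be infinite; in the discrete case the finite
   ones are integers. *)
Definition admissible (l : int) (X : {RV P >-> measurableTypeR R})
    (p : R -> R) : Prop :=
  if l == 0 then
    has_density lebesgue_measure X p /\
    exists a b : \bar R,
      closure (supp p) = [set x : R | (a <= x%:E)%E /\ (x%:E <= b)%E]
  else
    has_density counting_int X p /\
    exists a b : \bar int,
      supp p = [set z%:~R | z in [set z : int | (a <= z%:E)%E /\ (z%:E <= b)%E]].

(* The law of [X] gives no mass to the complement of [supp p], so nothing,
   not even measurability, is asked of [f] there. *)
Definition L1 (X : {RV P >-> measurableTypeR R}) (p : R -> R) (f : R -> R)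
    : Prop :=
  (distribution P X).-integrable (supp p) (fun x => (f x)%:E).

Definition independent2 (X Y : {RV P >-> measurableTypeR R}) : Prop :=
  forall A B : set (measurableTypeR R), measurable A -> measurable B ->
    P (X @^-1` A `&` Y @^-1` B) = (P (X @^-1` A) * P (Y @^-1` B))%E.

Definition Emx m n (M : T -> 'M[R]_(m, n)) : 'M[R]_(m, n) :=
  \matrix_(i, j) fine 'E_P[fun w => M w i j].

Definition integrable_mx m n (M : T -> 'M[R]_(m, n)) : Prop :=
  forall i j, P.-integrable [set: T] (fun w => (M w i j)%:E).

End Probability.
Arguments Emx {d T R} P {m n} M.
Arguments integrable_mx {d T R} P {m n} M.

Definition R_integrand (R : realType) (r : nat) (l : int) (p : R -> R)
    (u v : R) (vv : R -> 'cV[R]_r) (g : R -> R) (x3 x4 : R) : 'M[R]_r :=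
  let delta := g x4 *: vv x3 - g x3 *: vv x4 in
  Phi2 l p u x3 x4 v *: (delta *m delta^T).

Definition Rmx d (T : measurableType d) (R : realType) (P : probability T R)
    (X3 X4 : {RV P >-> measurableTypeR R}) (r : nat) (l : int) (p : R -> R)
    (u v : R) (vv : R -> 'cV[R]_r) (g : R -> R) : 'M[R]_r :=
  Emx P (fun w => R_integrand l p u v vv g (X3 w) (X4 w)).

(* Main.v *)
Require Import Defs.
From HB Require Import structures.
From mathcomp Require Import all_boot all_order all_algebra.
From mathcomp Require Import all_classical all_reals all_analysis.
From mathcomp Require Import measurable_realfun.
From mathcomp Require Import ring lra zify.
Set Implicit Arguments.
Unset Strict Implicit.
Unset Printing Implicit Defensive.
Import Order.TTheory GRing.Theory Num.Theory.
Import numFieldNormedType.Exports.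

Local Open Scope classical_set_scope.
Local Open Scope ring_scope.

(** The identity is Lagrange's identity for the measure with density
    [x |-> Phi l p u x v] with respect to the law [nu] of [X].  Write [phi x]
    for this density.  For two points [x], [y] put
<<
      h (x, y) = (g y v_i x - g x v_i y) (g y v_j x - g x v_j y) phi x phi y.
>>
    Expanding the product and using Fubini, the integral of [h] against
    [nu \x nu] is
    2 (E[v_i v_j phi] E[g^2 phi] - E[v_i g phi] E[v_j g phi]).

    The remainder integrates [h] only over one half of the square.  Indeed
    [Phi2 l p u x y v] is [phi x * phi y] restricted to the pairs ordered by
    the middle factor [chi (l ^+ 2) x y], because the order of [x] and [y]
    turns the two outer constraints into the four constraints of the two
    kernels (lemma [Phi2_chi]).  Now [h] is symmetric and vanishes on the
    diagonal, while for [x != y] in the support exactly one of [(x, y)] and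
    [(y, x)] is ordered: [x <= y] decides in the continuous case, and
    [x <= y - 1] in the discrete case, where the points are integers (lemma
    [chi_sq_xor]).  So the ordered half carries half of the integral (lemma
    [Rintegral_symmetric_half]), and the factor 2
    cancels.  The diagonal needs no null set argument, so atoms of [nu] do
    no harm.

    Neither [g] nor [v_k] need be measurable, so every integrability claim goes
    through the products [g^2 phi], [v_k g phi] and [v_i v_j phi], which are
    integrable on the support of [p].  Since [phi] is zero elsewhere, they are
    integrable on the whole line (lemma [L1_integrable]), and [h] is a
    polynomial in their values at [x] and [y]. *)

(** * Expectations under a law, and integrals over a product *)

Lemma integrable_comp_law d d' (T : measurableType d) (S : measurableType d')
    (R : realType) (P : probability T R) (X : {mfun T >-> S}) (f : S -> R) :
  (distribution P X).-integrable [set: S] (EFin \o f) ->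
  P.-integrable [set: T] (EFin \o (f \o X)).
Proof.
move=> /integrableP[mf foo]; apply/integrableP; split.
  by apply/measurable_EFinP; apply: measurableT_comp; first exact/measurable_EFinP.
apply: le_lt_trans foo.
rewrite (ge0_integral_distribution X (f := abse \o (EFin \o f)))//.
  exact: measurableT_comp mf.
by move=> y; exact: abse_ge0.
Qed.

Lemma Rintegral_law d d' (T : measurableType d) (S : measurableType d')
    (R : realType) (P : probability T R) (X : {mfun T >-> S}) (f : S -> R) :
  (distribution P X).-integrable [set: S] (EFin \o f) ->
  \int[distribution P X]_x f x = \int[P]_w f (X w).
Proof.
move=> intf; congr fine; apply: integral_distribution.
  by case/integrableP: intf.
exact: integrable_comp_law.
Qed.

Lemma integrable_tensor d d' (S : measurableType d) (S' : measurableType d')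
    (R : realType) (m : {sigma_finite_measure set S -> \bar R})
    (m' : {sigma_finite_measure set S' -> \bar R}) (f : S -> R) (f' : S' -> R) :
  m.-integrable setT (EFin \o f) -> m'.-integrable setT (EFin \o f') ->
  (m \x m')%E.-integrable setT (EFin \o (fun z => f z.1 * f' z.2)).
Proof.
move=> intf intf'.
have mf : measurable_fun setT f.
  by apply/measurable_EFinP; case/integrableP: intf.
have mf' : measurable_fun setT f'.
  by apply/measurable_EFinP; case/integrableP: intf'.
apply/integrable12ltyP.
  apply/measurable_EFinP; apply: measurable_funM; exact: measurableT_comp.
(* The inner integral is finite, so it factors out as a real constant. *)
have [I I_] : exists I, (\int[m']_y `|(f' y)%:E| = I%:E)%E.
  exists (fine (\int[m']_y `|(f' y)%:E|)%E); rewrite fineK//.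
  exact: (integrable_fin_num _ (integrable_abse intf')).
rewrite (eq_integral (fun x => `|(f x)%:E| * I%:E)%E); last first.
  move=> x _; rewrite -I_ /= -integralZl//; last exact: (integrable_abse intf').
  by apply: eq_integral => y _; rewrite /= normrM EFinM.
rewrite integralZr//; last exact: (integrable_abse intf).
rewrite -(fineK (integrable_fin_num _ (integrable_abse intf)))//.
by rewrite -EFinM ltry.
Qed.

Lemma Rintegral_tensor d d' (S : measurableType d) (S' : measurableType d')
    (R : realType) (m : {sigma_finite_measure set S -> \bar R})
    (m' : {sigma_finite_measure set S' -> \bar R}) (f : S -> R) (f' : S' -> R) :
  m.-integrable setT (EFin \o f) -> m'.-integrable setT (EFin \o f') ->
  \int[(m \x m')%E]_z (f z.1 * f' z.2) = \int[m]_x f x * \int[m']_y f' y.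
Proof.
move=> intf intf'.
rewrite /Rintegral -integral12_prod_meas1; last exact: integrable_tensor.
rewrite /fubini_F /=.
rewrite (eq_integral (fun x => (f x)%:E * (\int[m']_y f' y)%:E)%E); last first.
  move=> x _; rewrite /Rintegral fineK; last exact: integrable_fin_num.
  by rewrite -integralZl//; apply: eq_integral => y _; rewrite EFinM.
rewrite integralZr// fineM//; exact: integrable_fin_num.
Qed.

Lemma Rintegral_swap d (S : measurableType d) (R : realType)
    (m : {sigma_finite_measure set S -> \bar R}) (f : S * S -> R) :
  (m \x m)%E.-integrable setT (EFin \o f) ->
  (m \x m)%E.-integrable setT (EFin \o (f \o swap_pair)) ->
  \int[(m \x m)%E]_z f (swap_pair z) = \int[(m \x m)%E]_z f z.
Proof.
move=> intf intfs; congr fine.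
by rewrite -(integral12_prod_meas1 intf) -(integral21_prod_meas1 intfs).
Qed.

(** The function [c] selects one point from each pair [z], [swap_pair z] at
    which [h] is not zero.  By symmetry the selected and the discarded points
    contribute equally. *)
Lemma Rintegral_symmetric_half d (S : measurableType d) (R : realType)
    (m : {sigma_finite_measure set S -> \bar R}) (c : S * S -> bool)
    (h : S * S -> R) :
  measurable_fun setT c -> (m \x m)%E.-integrable setT (EFin \o h) ->
  (forall z, h (swap_pair z) = h z) ->
  (forall z, h z != 0 -> c z (+) c (swap_pair z)) ->
  (m \x m)%E.-integrable setT (EFin \o (fun z => (c z)%:R * h z)) /\
  \int[(m \x m)%E]_z h z = 2 * \int[(m \x m)%E]_z ((c z)%:R * h z).
Proof.
move=> mc inth hs hc.
have mh : measurable_fun setT h.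
  by apply/measurable_EFinP; case/integrableP: inth.
have intc (b : S * S -> bool) : measurable_fun setT b ->
    (m \x m)%E.-integrable setT (EFin \o (fun z => (b z)%:R * h z)).
  move=> mb; apply: le_integrable inth => //.
    apply/measurable_EFinP; apply: measurable_funM => //.
    rewrite (_ : (fun z => _) = (fun z => if b z then 1 else 0)).
      exact: measurable_fun_ifT.
    by apply/funext => z; case: (b z).
  by move=> z _ /=; rewrite lee_fin; case: (b z); rewrite ?mul1r ?mul0r ?normr0.
have mcs : measurable_fun setT (c \o swap_pair).
  by apply: measurableT_comp => //; exact: measurable_swap.
split; first exact: intc.
have ints : (m \x m)%E.-integrable setT
    (EFin \o ((fun z => (c z)%:R * h z) \o swap_pair)).
  rewrite (_ : _ \o swap_pair = fun z => (c (swap_pair z))%:R * h z).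
    exact: (intc _ mcs).
  by apply/funext => z /=; rewrite hs.
rewrite mulr_natl mulr2n -[X in X + _]Rintegral_swap//; last exact: intc.
rewrite -RintegralD//; last exact: intc.
apply: eq_Rintegral => z _ /=; rewrite hs.
have [->|/hc] := eqVneq (h z) 0; first by rewrite !mulr0 addr0.
by case: (c z); case: (c (swap_pair z)); rewrite //= ?mul1r ?mul0r ?addr0 ?add0r.
Qed.

Section Independence.
Context d d' (T : measurableType d) (S : measurableType d') (R : realType).
Context (P : probability T R) (Y Z : {mfun T >-> S}).

Definition pair_rv (w : T) : S * S := (Y w, Z w).

HB.instance Definition _ := isMeasurableFun.Build _ _ _ _ pair_rv
  (measurable_fun_pair (measurable_funPT Y) (measurable_funPT Z)).

(** Independence says that the joint law agrees with [m \x m] on rectangles,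
    which determine a product of sigma-finite measures. *)
Lemma integral_iid (m : probability S R) (f : S * S -> R) :
  (forall A, measurable A -> distribution P Y A = m A) ->
  (forall A, measurable A -> distribution P Z A = m A) ->
  (forall A B, measurable A -> measurable B ->
    P (Y @^-1` A `&` Z @^-1` B) = (P (Y @^-1` A) * P (Z @^-1` B))%E) ->
  (m \x m)%E.-integrable setT (EFin \o f) ->
  \int[P]_w f (Y w, Z w) = \int[(m \x m)%E]_z f z.
Proof.
move=> mY mZ indep intf.
have law A : measurable A -> (m \x m)%E A = distribution P pair_rv A.
  apply: product_measure_unique => B C mB mC.
  transitivity (distribution P Y B * distribution P Z C)%E; first exact: indep.
  by congr (_ * _)%E; [exact: mY|exact: mZ].
have eq_law (h : S * S -> \bar R) :
    (\int[(m \x m)]_z h z = \int[distribution P pair_rv]_z h z)%E.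
  by apply: eq_measure_integral => A mA _; exact: law.
rewrite [RHS]/Rintegral eq_law -/(Rintegral _ _ _) Rintegral_law//.
have [mf foo] := integrableP _ _ _ intf.
by apply/integrableP; split; rewrite // -eq_law.
Qed.

End Independence.

(** * The kernels *)

Section Kernels.
Context (R : realType).
Implicit Types (p : R -> R) (u v x y : R) (l : int).

(** The middle constraint lies between the outer ones, so it propagates the
    lower bound from [x] to [y] and the upper bound from [y] to [x].  For
    [l = 1], for instance, [u + 1 <= x], [x + 1 <= y] and [y <= v] give
    [u + 1 <= y] and [x <= v]. *)
Lemma Phi2_chi l p u x y v : l \in [:: -1; 0; 1] ->
  Phi2 l p u x y v = chi (l ^+ 2) x y * (Phi l p u x v * Phi l p u y v).
Proof.
move=> hl; rewrite /Phi2 /Phi invfM.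
suff -> : chi l u x * chi (l ^+ 2) x y * chi (- l) y v =
    chi (l ^+ 2) x y * (chi l u x * chi (- l) x v * (chi l u y * chi (- l) y v)).
  by ring.
rewrite /chi -!natrM !mulnb; congr (nat_of_bool _)%:R.
apply/idP/idP; move: hl; rewrite !inE => /or3P[] /eqP ->;
  rewrite /= ?subr0 => H; lra.
Qed.

Lemma Phi_eq0 l p u x v : (forall x, 0 <= p x) -> ~ supp p x ->
  Phi l p u x v = 0.
Proof.
move=> p0 /negP; rewrite -leNgt => px.
by rewrite /Phi (@le_anti _ _ (p x) 0) ?p0 ?px// invr0 mulr0.
Qed.

End Kernels.

Section Density.
Context d (T : measurableType d) (R : realType) (P : probability T R).
Context (X : {RV P >-> measurableTypeR R}) (p : R -> R) (l : int).
Hypothesis hX : admissible l X p.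

Lemma admissible_density :
  measurable_fun [set: measurableTypeR R] (p : measurableTypeR R -> R) /\
  forall x, 0 <= p x.
Proof. by move: hX; rewrite /admissible; case: ifP => _ [[? ? _] _]. Qed.

Lemma measurable_supp : measurable (supp p : set (measurableTypeR R)).
Proof.
have [mp _] := admissible_density.
rewrite (_ : supp p = [set: measurableTypeR R] `&` p @^-1` `]0, +oo[%classic).
  exact: mp.
by apply/seteqP; split => [x ?|x []] /=; rewrite in_itv/= andbT.
Qed.

(** This is where integrability on the support, which says nothing about [f]
    elsewhere, becomes integrability and measurability on the whole line. *)
Lemma L1_integrable (f : R -> R) :
  L1 X p f -> (forall x, ~ supp p x -> f x = 0) ->
  (distribution P X).-integrable [set: measurableTypeR R] (EFin \o f).
Proof.
move=> /(integrable_mkcond _ measurable_supp) + f0.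
congr (integrable _ _ _); apply/funext => x; rewrite patchE /=.
by case: ifPn => // /negP; rewrite inE => /f0 ->.
Qed.

(** In the discrete case the strictness of [x <= y - 1] is compatible with
    totality only because distinct points of the support, being integers,
    differ by at least 1. *)
Lemma chi_sq_xor (x y : R) : l \in [:: -1; 0; 1] ->
  supp p x -> supp p y -> x != y ->
  (x <= y - (l ^+ 2 == 1)%:R) (+) (y <= x - (l ^+ 2 == 1)%:R).
Proof.
move=> hl; move: hX hl; rewrite /admissible.
have [->|l0] := eqVneq l 0.
  move=> _ _ _ _ xy; rewrite expr0n /= !subr0.
  by case: ltgtP xy.
move=> [_ [a [b ->]]] hl [z _ <-] [t _ <-] zt.
have -> : (l ^+ 2 == 1) = true.
  by move: hl l0; rewrite !inE => /or3P[] /eqP ->.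
rewrite -[_%:R]/(1%:~R) -!intrB !ler_int.
by move: zt; rewrite eqr_int; lia.
Qed.

End Density.

(** * Lagrange's identity *)

Theorem lemma2p4 (R : realType) (l : int) (hl : l \in [:: -1; 0; 1])
  (d : measure_display) (T : measurableType d) (P : probability T R)
  (X : {RV P >-> measurableTypeR R}) (p : R -> R) (hX : admissible l X p)
  (d' : measure_display) (T' : measurableType d') (P' : probability T' R)
  (X3 X4 : {RV P' >-> measurableTypeR R})
  (hX3 : forall A : set (measurableTypeR R), measurable A ->
           distribution P' X3 A = distribution P X A)
  (hX4 : forall A : set (measurableTypeR R), measurable A ->
           distribution P' X4 A = distribution P X A)
  (hind : independent2 X3 X4)
  (r : nat) (vv : R -> 'cV[R]_r) (g : R -> R)
  (hvg : forall k : 'I_r, L1 X p (fun x => vv x k 0 * g x))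
  (u v : R) (hu : u \in supp p) (hv : v \in supp p)
  (hvgPhi : forall k : 'I_r, L1 X p (fun x => vv x k 0 * g x * Phi l p u x v))
  (hvvPhi : forall i j : 'I_r,
     L1 X p (fun x => vv x i 0 * vv x j 0 * Phi l p u x v))
  (hggPhi : L1 X p (fun x => g x ^+ 2 * Phi l p u x v))
  (hR : integrable_mx P' (fun w => R_integrand l p u v vv g (X3 w) (X4 w))) :
  Emx P (fun w => (g (X w) * Phi l p u (X w) v) *: vv (X w)) *m
    Emx P (fun w => (g (X w) * Phi l p u (X w) v) *: (vv (X w))^T) =
  fine 'E_P[fun w => g (X w) ^+ 2 * Phi l p u (X w) v] *:
    Emx P (fun w => Phi l p u (X w) v *: (vv (X w) *m (vv (X w))^T))
  - Rmx X3 X4 l p u v vv g.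
Proof.
have [_ p0] := admissible_density hX.
pose phi x := Phi l p u x v.
have phi0 x : ~ supp p x -> phi x = 0 by exact: Phi_eq0.
pose nu : probability (measurableTypeR R) R := distribution P X.
pose B k x := vv x k 0 * g x * phi x.
pose C i j x := vv x i 0 * vv x j 0 * phi x.
pose A x := g x ^+ 2 * phi x.
have iB k : nu.-integrable setT (EFin \o B k).
  by apply: (L1_integrable hX) (hvgPhi k) _ => x /phi0;
    rewrite /phi => ->; rewrite mulr0.
have iC i j : nu.-integrable setT (EFin \o C i j).
  by apply: (L1_integrable hX) (hvvPhi i j) _ => x /phi0;
    rewrite /phi => ->; rewrite mulr0.
have iA : nu.-integrable setT (EFin \o A).
  by apply: (L1_integrable hX) hggPhi _ => x /phi0;
    rewrite /phi => ->; rewrite mulr0.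
have EX (f : T -> R) (h : R -> R) : nu.-integrable setT (EFin \o h) ->
    (forall w, f w = h (X w)) -> fine 'E_P[f] = \int[nu]_x h x.
  move=> ih fh; rewrite unlock (Rintegral_law ih).
  by apply: eq_Rintegral => w _; rewrite fh.
apply/matrixP => i j.
rewrite !mxE big_ord1 !mxE.
rewrite (EX _ (B i) (iB i)); last by move=> w; rewrite !mxE /B /phi; ring.
rewrite (EX _ (B j) (iB j)); last by move=> w; rewrite !mxE /B /phi; ring.
rewrite (EX _ A iA)//.
rewrite (EX _ (C i j) (iC i j)); last first.
  by move=> w; rewrite !mxE big_ord1 !mxE /C /phi; ring.
pose h (z : measurableTypeR R * measurableTypeR R) : R :=
  (g z.2 * vv z.1 i 0 - g z.1 * vv z.2 i 0) *
  (g z.2 * vv z.1 j 0 - g z.1 * vv z.2 j 0) * (phi z.1 * phi z.2).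
pose c (z : measurableTypeR R * measurableTypeR R) : bool :=
  ((z.1 : R) <= (z.2 : R) - (l ^+ 2 == 1)%:R)%R.
have hE : h = (fun z => (C i j z.1 * A z.2 + A z.1 * C i j z.2) -
                        (B i z.1 * B j z.2 + B j z.1 * B i z.2)).
  by apply/funext => z; rewrite /h /A /B /C; ring.
have iCA := integrable_tensor (iC i j) iA.
have iAC := integrable_tensor iA (iC i j).
have iBiBj := integrable_tensor (iB i) (iB j).
have iBjBi := integrable_tensor (iB j) (iB i).
have iCA_sym := integrableD measurableT iCA iAC.
have iBiBj_sym := integrableD measurableT iBiBj iBjBi.
have ih : (nu \x nu)%E.-integrable setT (EFin \o h).
  by rewrite hE; apply: eq_integrable (integrableB measurableT iCA_sym iBiBj_sym).
have inth : \int[(nu \x nu)%E]_z h z =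
    2 * (\int[nu]_x C i j x * \int[nu]_x A x -
         \int[nu]_x B i x * \int[nu]_x B j x).
  rewrite hE RintegralB// !RintegralD// !Rintegral_tensor//.
  by ring.
have mc : measurable_fun setT c.
  apply: measurable_fun_ler; first exact: measurable_fst.
  by apply: measurable_funB => //; exact: measurable_snd.
have [|z|ich half] := Rintegral_symmetric_half mc ih.
- by move=> z; rewrite /h /=; ring.
- move=> hz; apply: (chi_sq_xor hX) => //.
  + by apply: contrapT => /phi0 z1; move: hz; rewrite /h z1 mul0r mulr0 eqxx.
  + by apply: contrapT => /phi0 z2; move: hz; rewrite /h z2 !mulr0 eqxx.
  + apply: contraNneq hz; case: z => x y /= ->; rewrite /h /=; apply/eqP; ring.
(* The integrand of the remainder is [h] on the ordered pairs, 0 elsewhere. *)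
have -> : fine 'E_P'[fun w => R_integrand l p u v vv g (X3 w) (X4 w) i j] =
    \int[(nu \x nu)%E]_z ((c z)%:R * h z).
  rewrite unlock -(integral_iid hX3 hX4 hind ich).
  apply: eq_Rintegral => w _.
  by rewrite !mxE big_ord1 !mxE Phi2_chi// /c /h /chi /phi /=; ring.
by move: half; rewrite inth; lra.
Qed.
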